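(* For every syntactic protocol $P$ (symmetric and epistemic), $P^\square=P^{\mathsf{HUBD}}$ and $P^\lozenge=P^{\mathsf{SUBD}}$, i.e. for every initial gossip graph $G$ the extension of $P^\square$ on $G$ equals $P^{\mathsf{HUBD}}(G)$ and the extension of $P^\lozenge$ on $G$ equals $P^{\mathsf{SUBD}}(G)$.
   Context: Let $A$ be a finite set of agents. A gossip graph is $G=(A,N,S)$ with $N,S\subseteq A\times A$ and $I\subseteq S\subseteq N$; $N_ab$: $a$ knows $b$'s number, $S_ab$: $a$ knows $b$'s secret. $G$ is initial if $S=I$. A call $ab$ ($a\neq b$) is possible iff $N_ab$; executing it yields $G^{ab}$ where $a$ and $b$ both get $N_a\cup N_b$ as numbers and $S_a\cup S_b$ as secrets, others unchanged; $G^{\sigma;ab}=(G^\sigma)^{ab}$. A gossip state is $(G,\sigma)$ with $G$ initial and $\sigma$ a sequence of calls each possible when made; $G^\sigma=(A,N^\sigma,S^\sigma)$. Formulas $\phi::=\top\mid N_ab\mid S_ab\mid\neg\phi\mid\phi\wedge\phi\mid K_a^P\phi\mid[\pi]\phi$, programs $\pi::=?\phi\mid ab\mid\pi;\pi\mid\pi\cup\pi\mid\pi^*$. A syntactic protocol $P$ is given by protocol conditions $P_{ab}$ (formulas, $a\neq b$), and as a program is $P=(\bigcup_{a\neq b}(?(N_ab\wedge P_{ab});ab))^*;?\bigwedge_{a\neq b}\neg(N_ab\wedge P_{ab})$. $\mathit{Ex}:=\bigwedge_{a,b}S_ab$; $\hat K=\neg K\neg$. Semantics: $N_ab$, $S_ab$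 true at $(G,\sigma)$ iff $N^\sigma_ab$, resp. $S^\sigma_ab$; $K_a^P\phi$ true iff $\phi$ true at all $(G,\sigma')\sim_a^P(G,\sigma)$; $[\pi]\phi$ true iff $\phi$ true at all states reachable by $\pi$, where the call $ab$ leads from $(G,\sigma)$ to $(G,\sigma;ab)$ if $N^\sigma_ab$ (and nowhere otherwise) and tests/composition/union/star are standard. A call $ab$ is $P$-permitted at $(G,\sigma)$ iff $G,\sigma\models N_ab\wedge P_{ab}$; $P(G)$ is the set of call sequences consisting of successively $P$-permitted calls (the extension). A semantic protocol is a prefix-closed function from initial gossip graphs to sets of call sequences; $ab$ is permitted at $(G,\sigma)$ iff $\sigma;ab\in P(G)$. Epistemic relation $\sim_a^P$: (1) $(G,\epsilon)\sim_a^P(G,\epsilon)$; (2) if $(G,\sigma)\sim_a^P(G,\tau)$, $N^\sigma_b=N^\tau_b$, $S^\sigma_b=S^\tau_b$ and $ab$ is $P$-permitted at both, then $(G,\sigma;ab)\sim_a^P(G,\tau;ab)$, likewise for $ba$; (3) if $(G,\sigma)\sim_a^P(G,\tau)$, $c,d,e,f\neq a$, $cd$ $P$-permitted at $(G,\sigma)$, $ef$ at $(G,\tau)$, then $(G,\sigma;cd)\sim_a^P(G,\tau;ef)$. Standing assumption: protocols are symmetric (for every permutation $J$ of agents, $P_{J(a)J(b)}$ is the formula obtained from $P_{ab}$ by renaming via $J$) and epistemic ($P_{ab}\rightarrow K_a^PP_{ab}$ valid). $\overline{P(G)}$ is the set of terminal $\sigma\in P(G)$ (no call $P$-permitted at $(G,\sigma)$).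 Hard and soft one-step strengthenings: syntactic protocols with $P^\square_{ab}:=P_{ab}\wedge K_a^P[ab](\mathit{Ex}\vee\bigvee_{i,j}(N_ij\wedge P_{ij}))$ and $P^\lozenge_{ab}:=P_{ab}\wedge\hat K_a^P[ab](\mathit{Ex}\vee\bigvee_{i,j}(N_ij\wedge P_{ij}))$. Hard/soft uniform backward defoliation: $P^{\mathsf{HUBD}}(G)$ is the set of $\sigma\in P(G)$ such that $\sigma=\epsilon$, or $\sigma=\tau;ab$ and for all $\tau'\in P(G)$ with $(G,\tau')\sim_a^P(G,\tau)$: if $\tau';ab\in\overline{P(G)}$ then $G,\tau';ab\models\mathit{Ex}$. $P^{\mathsf{SUBD}}(G)$ is the same with ''for all'' replaced by ''there exists''.
   Formalization: The displayed conditions for HUBD and SUBD restrict only the last call, so those sets need not be prefix-closed and the equality can fail (e.g. for LNS with four agents); here both are taken as the sequences all of whose prefixes satisfy the condition. *)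

(* Defs.v *)
From Stdlib Require Import Relation_Operators.
From mathcomp Require Import all_boot all_fingroup.

Set Implicit Arguments.
Unset Strict Implicit.
Unset Printing Implicit Defensive.

(* numbers G a = N_a and secrets G a = S_a, as rows of the relations N, S. *)
Record graph (A : finType) := Graph {
  numbers : A -> {set A};
  secrets : A -> {set A}
}.

Definition gossip_graph (A : finType) (G : graph A) : Prop :=
  forall a, a \in secrets G a /\ secrets G a \subset numbers G a.

Definition initial (A : finType) (G : graph A) : Prop :=
  gossip_graph G /\ forall a, secrets G a = [set a].

Definition call (A : finType) := {p : A * A | p.1 != p.2}.
Definition caller (A : finType) (c : call A) : A := (val c).1.
Definition callee (A : finType) (c : call A) : A := (val c).2.

Definition make_call (A : finType) (G : graph A) (c : call A) : graph A :=
  let a := caller c in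
  let b := callee c in
  Graph
    (fun x => if (x == a) || (x == b) then numbers G a :|: numbers G b
              else numbers G x)
    (fun x => if (x == a) || (x == b) then secrets G a :|: secrets G b
              else secrets G x).

(* Calls are executed from the head of the sequence; sigma;ab is
   rcons sigma ab. *)
Definition after (A : finType) (G : graph A) (sigma : seq (call A)) : graph A :=
  foldl (@make_call A) G sigma.

Definition possible (A : finType) (G : graph A) (sigma : seq (call A))
    (c : call A) : Prop :=
  callee c \in numbers (after G sigma) (caller c).

(* Sequences all of whose calls are allowed at the moment they are made. *)
Inductive successive (A : finType)
    (allowed : seq (call A) -> call A -> Prop) : seq (call A) -> Prop :=
| successive_nil : successive allowed [::]
| successive_rcons sigma c :
    successive allowed sigma -> allowed sigma c ->
    successive allowed (rcons sigma c).

Definition gossip_state (A : finType) (G : graph A)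
    (sigma : seq (call A)) : Prop :=
  initial G /\ successive (possible G) sigma.

(* A syntactic protocol is represented by its protocol conditions P_ab, one for
   each ordered pair a <> b, so that K carries such a family. *)
Inductive form (A : finType) : Type :=
| Top : form A
| Num : A -> A -> form A
| Sec : A -> A -> form A
| Neg : form A -> form A
| And : form A -> form A -> form A
| K : A -> (call A -> form A) -> form A -> form A
| Box : prog A -> form A -> form A
with prog (A : finType) : Type :=
| Test : form A -> prog A
| Do : call A -> prog A
| Comp : prog A -> prog A -> prog A
| Cup : prog A -> prog A -> prog A
| Star : prog A -> prog A.

Arguments Top {A}.

Definition protocol (A : finType) := call A -> form A.

Definition Or (A : finType) (phi psi : form A) : form A :=
  Neg (And (Neg phi) (Neg psi)).
Definition Imp (A : finType) (phi psi : form A) : form A :=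
  Neg (And phi (Neg psi)).
Definition Khat (A : finType) (a : A) (P : protocol A) (phi : form A) :
    form A :=
  Neg (K a P (Neg phi)).

Definition Ex (A : finType) : form A :=
  \big[@And A/Top]_(a : A) \big[@And A/Top]_(b : A) Sec a b.

(* The relation ~_a on call sequences from the fixed graph G, for the protocol
   whose permitted calls are given by perm. *)
Inductive indist (A : finType) (G : graph A)
    (perm : seq (call A) -> call A -> Prop) (a : A) :
    seq (call A) -> seq (call A) -> Prop :=
| indist_nil : indist G perm a [::] [::]
| indist_caller sigma tau c :
    indist G perm a sigma tau ->
    caller c = a ->
    numbers (after G sigma) (callee c) = numbers (after G tau) (callee c) ->
    secrets (after G sigma) (callee c) = secrets (after G tau) (callee c) ->
    perm sigma c -> perm tau c ->
    indist G perm a (rcons sigma c) (rcons tau c)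
| indist_callee sigma tau c :
    indist G perm a sigma tau ->
    callee c = a ->
    numbers (after G sigma) (caller c) = numbers (after G tau) (caller c) ->
    secrets (after G sigma) (caller c) = secrets (after G tau) (caller c) ->
    perm sigma c -> perm tau c ->
    indist G perm a (rcons sigma c) (rcons tau c)
| indist_other sigma tau c d :
    indist G perm a sigma tau ->
    caller c != a -> callee c != a -> caller d != a -> callee d != a ->
    perm sigma c -> perm tau d ->
    indist G perm a (rcons sigma c) (rcons tau d).

(* The K clause inlines [permitted] and [epi] below: truth, program steps and
   ~_a are defined by simultaneous recursion on the syntax. *)
Fixpoint sat (A : finType) (G : graph A) (sigma : seq (call A)) (phi : form A)
    {struct phi} : Prop :=
  match phi with
  | Top => True
  | Num a b => b \in numbers (after G sigma) a
  | Sec a b => b \in secrets (after G sigma) a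
  | Neg psi => ~ sat G sigma psi
  | And psi chi => sat G sigma psi /\ sat G sigma chi
  | K a P psi =>
      forall tau,
        indist G (fun rho c => possible G rho c /\ sat G rho (P c)) a
          tau sigma ->
        sat G tau psi
  | Box pi psi => forall tau, step G pi sigma tau -> sat G tau psi
  end
with step (A : finType) (G : graph A) (pi : prog A)
    (sigma tau : seq (call A)) {struct pi} : Prop :=
  match pi with
  | Test phi => tau = sigma /\ sat G sigma phi
  | Do c => possible G sigma c /\ tau = rcons sigma c
  | Comp pi1 pi2 => exists rho, step G pi1 sigma rho /\ step G pi2 rho tau
  | Cup pi1 pi2 => step G pi1 sigma tau \/ step G pi2 sigma tau
  | Star pi1 => clos_refl_trans (seq (call A)) (step G pi1) sigma tau
  end.

Definition valid (A : finType) (phi : form A) : Prop :=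
  forall (G : graph A) (sigma : seq (call A)),
    gossip_state G sigma -> sat G sigma phi.

Definition permitted (A : finType) (P : protocol A) (G : graph A)
    (sigma : seq (call A)) (c : call A) : Prop :=
  sat G sigma (And (Num (caller c) (callee c)) (P c)).

Definition epi (A : finType) (P : protocol A) (G : graph A) (a : A) :
    seq (call A) -> seq (call A) -> Prop :=
  indist G (permitted P G) a.

Definition extension (A : finType) (P : protocol A) (G : graph A) :
    seq (call A) -> Prop :=
  successive (permitted P G).

Definition terminal (A : finType) (P : protocol A) (G : graph A)
    (sigma : seq (call A)) : Prop :=
  extension P G sigma /\ forall c, ~ permitted P G sigma c.

Lemma rename_call_subproof (A : finType) (J : {perm A}) (c : call A) :
  J (caller c) != J (callee c).
Proof. by rewrite (inj_eq perm_inj); exact: (valP c). Qed.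

Definition rename_call (A : finType) (J : {perm A}) (c : call A) : call A :=
  exist (fun p : A * A => p.1 != p.2) (J (caller c), J (callee c))
    (rename_call_subproof J c).

(* Renaming a protocol Q inside a formula gives the protocol whose condition for
   J(a)J(b) is the renaming of Q_ab, whence the inverse in the K clause. *)
Fixpoint rename (A : finType) (J : {perm A}) (phi : form A) : form A :=
  match phi with
  | Top => Top
  | Num a b => Num (J a) (J b)
  | Sec a b => Sec (J a) (J b)
  | Neg psi => Neg (rename J psi)
  | And psi chi => And (rename J psi) (rename J chi)
  | K a Q psi =>
      K (J a) (fun c => rename J (Q (rename_call J^-1%g c))) (rename J psi)
  | Box pi psi => Box (rename_prog J pi) (rename J psi)
  end
with rename_prog (A : finType) (J : {perm A}) (pi : prog A) : prog A :=
  match pi with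
  | Test phi => Test (rename J phi)
  | Do c => Do (rename_call J c)
  | Comp pi1 pi2 => Comp (rename_prog J pi1) (rename_prog J pi2)
  | Cup pi1 pi2 => Cup (rename_prog J pi1) (rename_prog J pi2)
  | Star pi1 => Star (rename_prog J pi1)
  end.

(* Identity of formulas up to the order and bracketing of conjunctions and
   unions. Finite conjunctions such as Ex are indexed by sets of agents, so the
   arbitrary enumeration order used to write them with a binary connective must
   not matter: under Leibniz equality not even Ex is its own renaming. *)
Inductive form_eq (A : finType) : form A -> form A -> Prop :=
| form_eq_refl phi : form_eq phi phi
| form_eq_sym phi psi : form_eq phi psi -> form_eq psi phi
| form_eq_trans phi psi chi :
    form_eq phi psi -> form_eq psi chi -> form_eq phi chi
| form_eq_andC phi psi : form_eq (And phi psi) (And psi phi)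
| form_eq_andA phi psi chi :
    form_eq (And phi (And psi chi)) (And (And phi psi) chi)
| form_eq_neg phi psi : form_eq phi psi -> form_eq (Neg phi) (Neg psi)
| form_eq_and phi phi' psi psi' :
    form_eq phi phi' -> form_eq psi psi' ->
    form_eq (And phi psi) (And phi' psi')
| form_eq_K a P Q phi psi :
    (forall c, form_eq (P c) (Q c)) -> form_eq phi psi ->
    form_eq (K a P phi) (K a Q psi)
| form_eq_box pi rho phi psi :
    prog_eq pi rho -> form_eq phi psi -> form_eq (Box pi phi) (Box rho psi)
with prog_eq (A : finType) : prog A -> prog A -> Prop :=
| prog_eq_refl pi : prog_eq pi pi
| prog_eq_sym pi rho : prog_eq pi rho -> prog_eq rho pi
| prog_eq_trans pi rho chi :
    prog_eq pi rho -> prog_eq rho chi -> prog_eq pi chi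
| prog_eq_cupC pi rho : prog_eq (Cup pi rho) (Cup rho pi)
| prog_eq_cupA pi rho chi :
    prog_eq (Cup pi (Cup rho chi)) (Cup (Cup pi rho) chi)
| prog_eq_test phi psi : form_eq phi psi -> prog_eq (Test phi) (Test psi)
| prog_eq_comp pi pi' rho rho' :
    prog_eq pi pi' -> prog_eq rho rho' ->
    prog_eq (Comp pi rho) (Comp pi' rho')
| prog_eq_cup pi pi' rho rho' :
    prog_eq pi pi' -> prog_eq rho rho' ->
    prog_eq (Cup pi rho) (Cup pi' rho')
| prog_eq_star pi rho : prog_eq pi rho -> prog_eq (Star pi) (Star rho).

Definition symmetric_protocol (A : finType) (P : protocol A) : Prop :=
  forall (J : {perm A}) (c : call A),
    form_eq (P (rename_call J c)) (rename J (P c)).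

Definition epistemic_protocol (A : finType) (P : protocol A) : Prop :=
  forall c : call A, valid (Imp (P c) (K (caller c) P (P c))).

Definition some_permitted (A : finType) (P : protocol A) : form A :=
  \big[@Or A/Neg Top]_(c : call A) And (Num (caller c) (callee c)) (P c).

Definition hard (A : finType) (P : protocol A) : protocol A := fun c =>
  And (P c)
    (K (caller c) P (Box (Do c) (Or (Ex A) (some_permitted P)))).

Definition soft (A : finType) (P : protocol A) : protocol A := fun c =>
  And (P c)
    (Khat (caller c) P (Box (Do c) (Or (Ex A) (some_permitted P)))).

Definition hubd_clause (A : finType) (P : protocol A) (G : graph A)
    (sigma : seq (call A)) : Prop :=
  extension P G sigma /\
  (sigma = [::] \/
   exists tau c, sigma = rcons tau c /\
     forall tau', extension P G tau' -> epi P G (caller c) tau' tau ->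
       terminal P G (rcons tau' c) -> sat G (rcons tau' c) (Ex A)).

Definition subd_clause (A : finType) (P : protocol A) (G : graph A)
    (sigma : seq (call A)) : Prop :=
  extension P G sigma /\
  (sigma = [::] \/
   exists tau c, sigma = rcons tau c /\
     exists tau', [/\ extension P G tau', epi P G (caller c) tau' tau &
       terminal P G (rcons tau' c) -> sat G (rcons tau' c) (Ex A)]).

(* A semantic protocol is a prefix-closed set of call sequences. The clauses
   above constrain only the last call and, read alone, need not give a
   prefix-closed set; the semantic protocols they define consist of the
   sequences all of whose prefixes satisfy the clause. *)
Definition HUBD (A : finType) (P : protocol A) (G : graph A)
    (sigma : seq (call A)) : Prop :=
  forall rho, prefix rho sigma -> hubd_clause P G rho.

Definition SUBD (A : finType) (P : protocol A) (G : graph A)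
    (sigma : seq (call A)) : Prop :=
  forall rho, prefix rho sigma -> subd_clause P G rho.

(* Main.v *)
Require Import Defs.
From mathcomp Require Import all_boot all_fingroup.
From Stdlib Require Import Classical.

(** Epistemically equivalent states give the agent the same numbers and, the
    protocol being epistemic, the same truth value of its protocol conditions;
    so a call [ab] that is permitted at [tau] is permitted at every [tau']
    that [a] confuses with [tau].  Hence [tau';ab] always lies in the extension,
    and "if [tau';ab] is terminal then [Ex] holds" says exactly that [Ex] or
    some permitted call is available after [tau';ab]. *)

Set Implicit Arguments.
Unset Strict Implicit.
Unset Printing Implicit Defensive.

Lemma successive_rconsE (A : finType)
    (allowed : seq (call A) -> call A -> Prop) sigma c :
  successive allowed (rcons sigma c) <->
  successive allowed sigma /\ allowed sigma c.
Proof.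
split=> [H|[Hs Hc]]; last exact: successive_rcons.
case: {-1}_ / H (erefl (rcons sigma c)) => [|tau d Ht Hd].
  by move/(congr1 size); rewrite size_rcons.
by move/rcons_inj=> [-> ->].
Qed.

Lemma successive_impl (A : finType)
    (allowed allowed' : seq (call A) -> call A -> Prop) sigma :
  (forall tau c, allowed tau c -> allowed' tau c) ->
  successive allowed sigma -> successive allowed' sigma.
Proof.
move=> sub; elim=> [|tau c _ IH Hc]; first exact: successive_nil.
by apply: successive_rcons => //; apply: sub.
Qed.

Lemma prefix_rconsE (T : eqType) (rho sigma : seq T) c :
  prefix rho (rcons sigma c) = (rho == rcons sigma c) || prefix rho sigma.
Proof.
apply/idP/idP => [/prefixP[s]|/orP[/eqP->|/prefixP[s ->]]].
- case/lastP: s => [|s d]; first by rewrite cats0 => ->; rewrite eqxx.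
  by rewrite -rcons_cat => /rcons_inj[-> _]; rewrite prefix_prefix orbT.
- exact: prefix_refl.
- by rewrite rcons_cat prefix_prefix.
Qed.

(** Reduces each equality of extensions to a comparison call by call: [allowed] stands for [P],
    [allowed'] for a strengthening, [Q] for the defoliation condition on the last call. A prefix of
    [rcons sigma c] is the whole sequence or a prefix of [sigma], so induction on the last call
    applies, and [tau] may be assumed to lie in the larger extension. *)
Lemma successive_restrict (A : finType)
    (allowed allowed' Q : seq (call A) -> call A -> Prop) :
  (forall tau c, allowed' tau c -> allowed tau c) ->
  (forall tau c, successive allowed tau -> allowed tau c ->
     (allowed' tau c <-> Q tau c)) ->
  forall sigma, successive allowed' sigma <->
    forall rho, prefix rho sigma -> successive allowed rho /\
      (rho = [::] \/ exists tau c, rho = rcons tau c /\ Q tau c).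
Proof.
move=> sub E; elim/last_ind=> [|sigma c IH].
  split=> [_ rho|_]; last exact: successive_nil.
  by rewrite prefixs0 => /eqP->; split; [exact: successive_nil | left].
split=> [H rho|H].
  have Ha := successive_impl sub H.
  have /successive_rconsE[Hs Hc] := H; have /successive_rconsE[Has Hac] := Ha.
  rewrite prefix_rconsE => /orP[/eqP->|]; last by apply: (proj1 IH).
  by split=> //; right; exists sigma, c; split=> //; apply/E.
have [/successive_rconsE[Hs Hc] HQ] := H _ (prefix_refl _).
apply/successive_rconsE; split.
  by apply/IH => rho Hr; apply: H; rewrite prefix_rconsE Hr orbT.
apply/E => //; case: HQ => [/(congr1 size)|[tau [d []]]].
  by rewrite size_rcons.
by move/rcons_inj=> [-> ->].
Qed.

Section Satisfaction.
Variables (A : finType) (G : graph A) (sigma : seq (call A)).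

Lemma sat_Or phi psi : sat G sigma (Or phi psi) <-> sat G sigma phi \/ sat G sigma psi.
Proof. by rewrite /=; tauto. Qed.

Lemma sat_Imp phi psi : sat G sigma (Imp phi psi) <-> (sat G sigma phi -> sat G sigma psi).
Proof. by rewrite /=; tauto. Qed.

Lemma sat_Khat a (P : protocol A) phi :
  sat G sigma (Khat a P phi) <-> exists2 tau, epi P G a tau sigma & sat G tau phi.
Proof.
split=> /= [H|[tau Ht Hphi] /(_ tau Ht)//].
(* Extracting a witness from a negated universal is classical. *)
by apply: NNPP => N; apply: H => tau Ht Hphi; apply: N; exists tau.
Qed.

Lemma sat_Do c phi :
  sat G sigma (Box (Do c) phi) <->
  (possible G sigma c -> sat G (rcons sigma c) phi).
Proof. by split=> /= [H Hc|H tau [Hc ->]]; apply: H. Qed.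

Lemma sat_some_permitted (P : protocol A) :
  sat G sigma (some_permitted P) <-> exists c, permitted P G sigma c.
Proof.
rewrite /some_permitted.
(* The enumeration of all calls is generalised to an arbitrary list to allow induction; the empty
   disjunction is [Neg Top]. *)
suff E (r : seq (call A)) :
    sat G sigma (\big[@Or A/Neg Top]_(c <- r) And (Defs.Num (caller c) (callee c)) (P c))
    <-> exists2 c, c \in r & permitted P G sigma c.
  split=> [/E[c _ Hc]|[c Hc]]; first by exists c.
  by apply/E; exists c => //; rewrite mem_index_enum.
elim: r => [|d r IH]; first by rewrite big_nil; split=> [/(_ I)|[]].
rewrite big_cons; split=> [/sat_Or[Hd|/IH[c cr Hc]]|[c]].
- by exists d => //; rewrite mem_head.
- by exists c => //; rewrite inE cr orbT.
- rewrite inE => /orP[/eqP-> Hd|cr Hc]; apply/sat_Or; first by left.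
  by right; apply/IH; exists c.
Qed.

End Satisfaction.

Section Indistinguishability.
Variables (A : finType) (G : graph A) (perm : seq (call A) -> call A -> Prop).

Lemma after_rcons sigma (c : call A) :
  after G (rcons sigma c) = make_call (after G sigma) c.
Proof. exact: foldl_rcons. Qed.

Lemma indist_successive a sigma tau :
  indist G perm a sigma tau -> successive perm sigma /\ successive perm tau.
Proof. by elim=> *; split; try constructor; tauto. Qed.

(** A call involving [a] merges equal rows of [a] with rows of the partner that the relation
    requires to be equal; any other call leaves the row of [a] unchanged. *)
Lemma indist_numbers a sigma tau :
  indist G perm a sigma tau -> numbers (after G sigma) a = numbers (after G tau) a.
Proof.
elim=> {sigma tau}
  [//|sigma tau c _ IH ca E _ _ _|sigma tau c _ IH ca E _ _ _
  |sigma tau c d _ IH ca cb da db _ _]; rewrite !after_rcons /=.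
- by rewrite ca eqxx IH E.
- by rewrite ca eqxx orbT IH E.
- by rewrite !(eq_sym a) (negPf ca) (negPf cb) (negPf da) (negPf db).
Qed.

End Indistinguishability.

Section Strengthenings.
Variables (A : finType) (P : protocol A) (Pepi : epistemic_protocol P).
Variables (G : graph A) (Ginit : initial G).

Lemma epi_permitted c tau' tau :
  epi P G (caller c) tau' tau -> permitted P G tau c -> permitted P G tau' c.
Proof.
move=> E [Hn HP]; have [_ Htau] := indist_successive E.
split; first by rewrite /= (indist_numbers E).
suff /sat_Imp/(_ HP) HK : sat G tau (Imp (P c) (K (caller c) P (P c))).
  exact: HK.
(* Validity covers gossip states only; [tau] yields one because permitted calls are possible. *)
apply: Pepi; split=> //.
by apply: successive_impl Htau => rho d [].
Qed.

Lemma sat_Do_Ex_or_permitted c tau :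
  extension P G tau -> permitted P G tau c ->
  sat G tau (Box (Do c) (Or (Ex A) (some_permitted P))) <->
  (terminal P G (rcons tau c) -> sat G (rcons tau c) (Ex A)).
Proof.
move=> Htau Hc; split=> [/sat_Do/(_ (proj1 Hc))/sat_Or[//|]|H].
  by move=> /sat_some_permitted[d Hd] [_ /(_ d)].
apply/sat_Do => _; apply/sat_Or.
(* Since [rcons tau c] is in the extension, it is terminal exactly when no call is permitted
   there. *)
have [S|S] := classic (sat G (rcons tau c) (some_permitted P)); first by right.
left; apply: H; split; first exact: successive_rcons.
by move=> d Hd; apply: S; apply/sat_some_permitted; exists d.
Qed.

Lemma hard_permittedE tau c :
  extension P G tau -> permitted P G tau c ->
  permitted (hard P) G tau c <->
  forall tau', extension P G tau' -> epi P G (caller c) tau' tau ->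
    terminal P G (rcons tau' c) -> sat G (rcons tau' c) (Ex A).
Proof.
move=> Htau [Hn HP]; split=> [[_ [_ HK]] tau' Htau' E|H].
  by apply/(sat_Do_Ex_or_permitted Htau' (epi_permitted E (conj Hn HP)))/HK.
(* The [K] inside [hard] is indexed by [P] itself, so it ranges over the same [tau'] as the clause;
   their membership in the extension comes from [E]. *)
split=> //; split=> // tau' E; have [Htau' _] := indist_successive E.
apply/(sat_Do_Ex_or_permitted Htau' (epi_permitted E (conj Hn HP))).
exact: H.
Qed.

Lemma soft_permittedE tau c :
  extension P G tau -> permitted P G tau c ->
  permitted (soft P) G tau c <->
  exists tau', [/\ extension P G tau', epi P G (caller c) tau' tau &
    terminal P G (rcons tau' c) -> sat G (rcons tau' c) (Ex A)].
Proof.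
move=> Htau Hc.
(* The conjunct [P c] holds by [Hc], which leaves only the [Khat] part; both sides then share the
   witness [tau']. *)
have -> : permitted (soft P) G tau c <->
    sat G tau (Khat (caller c) P (Box (Do c) (Or (Ex A) (some_permitted P)))).
  by split=> [[_ []]//|HK]; case: Hc => Hn HP; split=> //; split.
rewrite sat_Khat; split=> [[tau' E H]|[tau' [Htau' E H]]]; exists tau' => //.
  have [Htau' _] := indist_successive E; split=> //.
  exact/(sat_Do_Ex_or_permitted Htau' (epi_permitted E Hc)).
exact/(sat_Do_Ex_or_permitted Htau' (epi_permitted E Hc)).
Qed.

End Strengthenings.

Theorem theorem26 (A : finType) (P : protocol A)
    (Psym : symmetric_protocol P) (Pepi : epistemic_protocol P)
    (G : graph A) (Ginit : initial G) :
  (forall sigma : seq (call A), extension (hard P) G sigma <-> HUBD P G sigma) /\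
  (forall sigma : seq (call A), extension (soft P) G sigma <-> SUBD P G sigma).
Proof.
(* [HUBD] and [SUBD] unfold to the prefix condition, with [Q] read off from the clause on the last
   call. *)
split; apply: successive_restrict.
- by move=> tau c [Hn [HP _]].
- exact: hard_permittedE.
- by move=> tau c [Hn [HP _]].
- exact: soft_permittedE.
Qed.
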